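(* Let $\{Q_j(z)\}_{j\ge0}$ be the spectral polynomials and $\psi$ the spectral measure of a non-explosive birth and death process on $\{0,1,\ldots\}$ with rates $\lambda_i>0$ ($i\ge0$), $\mu_i>0$ ($i\ge1$), $\mu_0=0$, and suppose the spectrum is discrete with support $\{\zeta_l\}_{l\ge0}$. Let $N\ge1$, let $\widetilde u_j^{(l)}=Q_j(\zeta_l)$ for $j,l\ge0$, let $Z_1,\ldots,Z_N$ be independent identically distributed random variables with probability measure $\psi$, $\bm{Z}=(Z_1,\ldots,Z_N)$, and regard $\bm{n}=\bm{n}(\bm{Z})$ as a random variable by taking $n_l=n_l(\bm{Z})=|\{k:Z_k=\zeta_l,\ k=1,\ldots,N\}|$, $l\ge0$. Define $$\mathcal{N}_j=\sum_{k=1}^NQ_j(Z_k)=\sum_{l\ge0}n_lQ_j(\zeta_l),\qquad j\ge1.$$ Let $\bm{x}=(x_0,x_1,x_2,\ldots)$ be a sequence of non-negative integers with $\sum_{j\ge0}x_j=N$, so that the dual polynomial $\binom{N}{\bm{n}^+}^{-1}Q_{\bm{n}}(\bm{x};\widetilde{\bm{u}})$ is indexed by $(x_1,x_2,\ldots)$ with $x_1+x_2+\cdots\le N$. Then: (a) $\binom{N}{\bm{n}^+}^{-1}Q_{\bm{n}}(\bm{x};\widetilde{\bm{u}})$ is a polynomial of degree $x_1+x_2+\cdots$ in $\{\mathcal{N}_j\}_{j\ge1}$ whose only term of maximal degree is $\prod_{j\ge1}\mathcal{N}_j^{x_j}$. (b) The total degree of $\bm{Z}$ in the dual polynomials indexed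 by $(x_1,x_2,\ldots)$ is $\sum_{j\ge1}jx_j$, with a single leading term of this degree.
   Context: Birth and death process: from state $i$ it moves to $i+1$ at rate $\lambda_i$ and to $i-1$ at rate $\mu_i$; non-explosive means only finitely many events occur in any finite time interval. Spectral polynomials: $Q_{-1}=0$, $Q_0=1$, $-zQ_n(z)=-(\lambda_n+\mu_n)Q_n(z)+\lambda_nQ_{n+1}(z)+\mu_nQ_{n-1}(z)$ for $n\ge0$, so $Q_n$ has degree $n$. With $\pi_0=1$, $\pi_j=\frac{\lambda_0\cdots\lambda_{j-1}}{\mu_1\cdots\mu_j}$, the spectral measure $\psi$ is the probability measure on $[0,\infty)$ such that the transition functions are $p_{ij}(t)=\pi_j\int_0^\infty e^{-zt}Q_i(z)Q_j(z)\,\psi(dz)$. Discrete spectrum with support $\{\zeta_l\}_{l\ge0}$ means that $\psi$ is a discrete measure with atoms of mass $\psi(\{\zeta_l\})>0$ at the distinct points $\zeta_l\ge0$. $\bm{n}^+=(n_0,n_1,\ldots)$ with $\sum_{l\ge0}n_l=N$, and $\binom{N}{\bm{n}^+}=N!/\prod_{l\ge0}n_l!$. The multivariate Krawtchouk polynomial $Q_{\bm{n}}(\bm{x};\widetilde{\bm{u}})$ is the coefficient of $\prod_{l\ge1}w_l^{n_l}$ in $$\prod_{j\ge0}\Big(\widetilde u_j^{(0)}+\sum_{l\ge1}w_l\widetilde u_j^{(l)}\Big)^{x_j}.$$ The dual polynomials have the generating function $$\sum_{\{\bm{x}:|\bm{x}|=N\}}\binom{N}{\bm{n}^+}^{-1}\binom{N}{\bm{x}}Q_{\bm{n}}(\bm{x};\widetilde{\bm{u}})\prod_{i\ge0}v_i^{x_i}=\prod_{k=1}^N\Big(v_0+\sum_{j\ge1}Q_j(Z_k)v_j\Big),$$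 where $|\bm{x}|=\sum_{j\ge0}x_j$ and $\binom{N}{\bm{x}}=N!/\prod_{j\ge0}x_j!$. The dual polynomial equals $1$ when $x_i=0$ for all $i\ge1$.
   Formalization: In (b), ''a single leading term'' is read as a nonzero multiple of one monomial symmetric polynomial in Z_1,…,Z_N with x_j exponents equal to j (one monomial up to permutation), since a single monomial fails for x=(N-1,1,0,…), N≥2; in (a) the leading term is up to a nonzero constant. *)

(* Defs.v *)
(* MathComp-Analysis.  The notations of mpoly clash with those of
   MathComp-Analysis and are not imported. *)
From HB Require Import structures.
From mathcomp Require Import all_boot all_order all_algebra.
From mathcomp Require Import (canonicals, coercions) mpoly.
From mathcomp Require Import all_classical all_reals all_analysis.
Import Order.TTheory GRing.Theory Num.Theory.
Import numFieldNormedType.Exports.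

Set Implicit Arguments.
Unset Strict Implicit.
Unset Printing Implicit Defensive.

Local Open Scope classical_set_scope.
Local Open Scope ring_scope.

Section BirthDeath.
Context {R : realType}.
Variables lam mu : nat -> R.

Definition jump_prob (i j : nat) : R :=
  if j == i.+1 then lam i / (lam i + mu i)
  else if j.+1 == i then mu i / (lam i + mu i)
  else 0.

Section Process.
Context {d : measure_display} {Om : measurableType d}.
(* Pr i is the law of the process started from i, Y n the state after the n-th
   event and S n the time spent in that state. *)
Variables (Pr : nat -> probability Om R)
  (Y : nat -> Om -> nat) (S : nat -> Om -> R).

(* The rates enter through the jump chain and the holding times: Y is a Markov
   chain with transition matrix jump_prob and, given Y, the S n are independent
   exponentials of rates lam (Y n) + mu (Y n).  All joint laws follow from the
   joint tails below. *)
Definition birth_death_process : Prop :=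
  [/\ forall n, measurable_fun [set: Om] (Y n),
      forall n, measurable_fun [set: Om] (S n) &
      forall (i n : nat) (y : nat -> nat) (s : nat -> R),
        (forall m, 0 <= s m) ->
        Pr i [set w | forall m, (m <= n)%N -> Y m w = y m /\ s m < S m w] =
        ((y 0%N == i)%:R *
         (\prod_(m < n) jump_prob (y m) (y m.+1)) *
         (\prod_(m < n.+1) expR (- ((lam (y m) + mu (y m)) * s m))))%:E].

Definition event_time (n : nat) (w : Om) : R := \sum_(m < n) S m w.

Definition non_explosive : Prop :=
  forall i, {ae Pr i, forall w, forall t : R,
    finite_set [set n | event_time n w <= t]}.

Definition in_state (t : R) (j : nat) : set Om :=
  [set w | exists n, event_time n w <= t < event_time n.+1 w /\ Y n w = j].

Definition transition (i j : nat) (t : R) : \bar R := Pr i (in_state t j).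

End Process.

Definition spectral_polynomials (Q : nat -> {poly R}) : Prop :=
  Q 0%N = 1 /\
  forall n, - ('X * Q n) =
    - ((lam n + mu n) *: Q n) + lam n *: Q n.+1
    + mu n *: (if n is m.+1 then Q m else 0).

Definition potential (j : nat) : R :=
  (\prod_(i < j) lam i) / (\prod_(i < j) mu i.+1).

Definition spectral_measure {d : measure_display} {Om : measurableType d}
    (Pr : nat -> probability Om R) (Y : nat -> Om -> nat) (S : nat -> Om -> R)
    (Q : nat -> {poly R}) (psi : probability R R) : Prop :=
  psi [set` `]-oo, 0[] = 0%E /\
  forall (i j : nat) (t : R), 0 <= t ->
    (transition Pr Y S i j t =
     (potential j)%:E *
     \int[psi]_(z in `[0%R, +oo[)
       (expR (- (z * t)) * (Q i).[z] * (Q j).[z])%:E)%E.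

End BirthDeath.

Definition discrete_spectrum {R : realType} (psi : probability R R)
    (zeta : nat -> R) : Prop :=
  [/\ injective zeta, forall l, 0 <= zeta l,
      forall l, (0 < psi [set zeta l])%E & psi (~` range zeta) = 0%E].

(* Taking some of the A k to be setT gives the product rule for subfamilies. *)
Definition independent_rvs {R : realType} {d : measure_display}
    {T : measurableType d} (P : probability T R) (N : nat)
    (Z : 'I_N -> {RV P >-> R}) : Prop :=
  forall A : 'I_N -> set R, (forall k, measurable (A k)) ->
    P [set w | forall k, A k (Z k w)] = (\prod_(k < N) P (Z k @^-1` A k))%E.

Definition iid_rvs {R : realType} {d : measure_display}
    {T : measurableType d} (P : probability T R) (N : nat)
    (Z : 'I_N -> {RV P >-> R}) (psi : probability R R) : Prop :=
  independent_rvs Z /\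
  forall k (A : set R), measurable A -> distribution P (Z k) A = psi A.

(* Variables and exponents are numbered from 1: the index i : 'I_L stands for
   the (i+1)-st variable. *)
Definition mpoly_var {R : realType} (L : nat) (i : 'I_L) : mpoly.mpoly L R :=
  mpoly.mpolyX R (mpoly.mnm1 i).

Definition mnm_shift (L : nat) (e : nat -> nat) : mpoly.multinom L :=
  mpoly.Multinom [tuple e i.+1 | i < L].

Section Krawtchouk.
Context {R : realType}.
(* u j l stands for the l-th vector at j, i.e. u_j^{(l)}.  The sequences n and x
   are finitely supported, and so are all the \big[_/_]_(_ \in _) below. *)
Variables (u : nat -> nat -> R) (n x : nat -> nat).

Definition last_index : nat := \big[maxn/0%N]_(l \in [set l | n l != 0%N]) l.

(* The variables w_l with l > L may be set to 0 when n vanishes beyond L: this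
   does not affect the coefficient of \prod_(l >= 1) w_l ^+ n l. *)
Definition krawtchouk_gf (L : nat) : mpoly.mpoly L R :=
  \big[*%R/1]_(j \in [set: nat])
    (mpoly.mpolyC L (u j 0%N) + \sum_(l < L) u j l.+1 *: mpoly_var l) ^+ x j.

Definition krawtchouk : R :=
  mpoly.mcoeff (mnm_shift last_index n) (krawtchouk_gf last_index).

Definition multinomial_coef (N : nat) : R :=
  (N`!)%:R / (\big[muln/1%N]_(l \in [set: nat]) (n l)`!)%:R.

Definition dual_krawtchouk (N : nat) : R :=
  (multinomial_coef N)^-1 * krawtchouk.

End Krawtchouk.

Definition occupation {R : realType} (zeta : nat -> R) (N : nat)
    (z : 'I_N -> R) (l : nat) : nat := #|[pred k | z k == zeta l]|.

(* The monomial symmetric polynomial in N variables of the partition having x j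
   parts equal to j for each j >= 1: the sum of the distinct monomials in which
   each exponent j is carried by exactly x j of the N variables. *)
Definition monomial_sym {R : realType} (N : nat) (x : nat -> nat) :
    mpoly.mpoly N R :=
  \sum_(m : mpoly.bmultinom N
              (\big[addn/0%N]_(j \in [set: nat]) (j * x j)%N).+1
        | `[< forall j : nat,
              #|[pred k | (m : mpoly.multinom N) k == j]| = x j >])
    mpoly.mpolyX R m.

(* P has total degree exactly d and top homogeneous component c *: M, with c
   a nonzero scalar. *)
Definition leading_form {R : realType} (N : nat) (d : nat)
    (P M : mpoly.mpoly N R) : Prop :=
  mpoly.msize P = d.+1 /\
  exists2 c : R, c != 0 & mpoly.pihomog mpoly.mdeg d P = c *: M.

(* Main.v *)
(* Label the N slots by a : 'I_N -> nat so that each j is used x j times.  When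
   Z_k = zeta (b k), expanding the generating function over all maps from slots
   to indices l and grouping these maps into orbits of 'S_N gives
     dual = 1/N! * \sum_s \prod_k Q_(a k) (Z_(s k)),
   a symmetrized product of spectral polynomials.  Its top coefficients in Z are
   products of leading coefficients, which gives (b).  For (a), multiplying the
   symmetrized product of a family p having r slots equal to 1 by the power sum
   of q puts q either in one of these r slots or on top of some p_k; so filling
   a slot equals multiplication by a power sum, up to terms with fewer filled
   slots, in which the products q * p_k are expanded in the basis Q. *)
Require Import Defs.
From HB Require Import structures.
From mathcomp Require Import all_boot all_order fingroup perm all_algebra.
From mathcomp Require Import (canonicals, coercions) mpoly.
From mathcomp Require Import all_classical all_reals all_analysis.
Import Order.TTheory GRing.Theory Num.Theory.
Import numFieldNormedType.Exports.

Set Implicit Arguments.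
Unset Strict Implicit.
Unset Printing Implicit Defensive.

Local Open Scope classical_set_scope.
Local Open Scope ring_scope.

(** * Labellings and their fibers *)

Lemma card_fiber_sum (N : nat) (a : 'I_N -> nat) (j : nat) :
  #|[pred k | a k == j]| = (\sum_(k < N) (a k == j))%N.
Proof.
rewrite -sum1_card big_mkcond; apply: eq_bigr => k _.
by rewrite inE; case: (_ == _).
Qed.

Lemma card_fiber_perm (N : nat) (a : 'I_N -> nat) (s : 'S_N) (j : nat) :
  #|[pred k | a (s k) == j]| = #|[pred k | a k == j]|.
Proof. by rewrite !card_fiber_sum [RHS](reindex_inj (@perm_inj _ s)). Qed.

(** Induction on N: [s ord0] ranges over the slots where [a] takes the value [f ord0], and deleting
    that slot and [ord0] leaves the same problem with one slot less. The number of choices is the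
    factor by which the factorial of that fiber drops. *)
Lemma card_perm_relabel (B N : nat) (a f : 'I_N -> nat) :
    (forall k, (f k < B)%N) ->
    (forall j, #|[pred k | a k == j]| = #|[pred k | f k == j]|) ->
  #|[pred s : 'S_N | [forall k, a (s k) == f k]]| =
  (\prod_(j < B) (#|[pred k | f k == j]|)`!)%N.
Proof.
elim: N a f => [|N IH] a f fB af.
  rewrite big1 => [|j _]; last by rewrite card_fiber_sum big_ord0.
  rewrite -[RHS]/(0`!)%N -(card_Sn 0); apply: eq_card => s.
  by rewrite !inE; apply/forallP => -[].
pose c := f ord0.
pose P := (\prod_(j < B) (#|[pred k | f (lift ord0 k) == j]|)`!)%N.
have fE j : #|[pred k | f k == j]| =
    ((c == j) + #|[pred k | f (lift ord0 k) == j]|)%N.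
  by rewrite !card_fiber_sum big_ord_recl.
have -> : (\prod_(j < B) (#|[pred k | f k == j]|)`!)%N =
    (#|[pred k | f k == c]| * P)%N.
  have cB : (c < B)%N by exact: fB.
  rewrite [LHS](bigD1 (Ordinal cB)) // /P [in RHS](bigD1 (Ordinal cB)) //.
  rewrite fE eqxx add1n factS -[LHS]mulnA; congr (_ * (_ * _))%N; apply: eq_bigr => j jc.
  by rewrite fE; case: eqP => // e; move: jc; rewrite -val_eqE /= -e eqxx.
rewrite -sum1_card (partition_big (fun s : 'S_N.+1 => s ord0) predT) //=.
rewrite -af -sum1_card big_distrl /= [RHS]big_mkcond /=.
apply: eq_bigr => i _; rewrite inE mul1n.
case: ifPn => [/eqP aic|aic]; last first.
  rewrite big_pred0 // => s; apply/negbTE; apply: contra aic.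
  by move=> /andP[/forallP/(_ ord0) + /eqP <-].
rewrite -[RHS](IH (a \o lift i) (f \o lift ord0)); first last.
- move=> j /=; have := af j; rewrite fE !card_fiber_sum (bigD1_ord i) //= aic.
  by move=> /addnI.
- by move=> k /=; exact: fB.
rewrite sum1_card; symmetry.
(* The permutations sending [ord0] to [i] are exactly the [lift_perm ord0 i t]. *)
rewrite -(@card_in_imset _ _ (lift_perm ord0 i)); last first.
  move=> s t _ _ /permP st; apply/permP => k.
  by have := st (lift ord0 k); rewrite !lift_perm_lift => /lift_inj.
apply: eq_card => s; rewrite [RHS]unfold_in inE /=; apply/imsetP/andP.
  move=> [t]; rewrite inE /= => /forallP H ->; split.
    apply/forallP => k; case: (unliftP ord0 k) => [k'|] ->.
      by rewrite lift_perm_lift; exact: H.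
    by rewrite lift_perm_id; exact/eqP.
  by rewrite lift_perm_id.
case=> /forallP H /eqP s0.
(* [g] is the map that [s] induces on the remaining slots. The default is never reached, since
   [s (lift ord0 k)] differs from [s ord0 = i]. *)
pose g k := odflt k (unlift i (s (lift ord0 k))).
have gE k : lift i (g k) = s (lift ord0 k).
  rewrite /g; case: unliftP => //= /eqP; rewrite -s0.
  by rewrite (inj_eq perm_inj) eq_sym (negbTE (neq_lift _ _)).
have gI : injective g.
  move=> k l gkl; apply: (@lift_inj _ ord0); apply: (@perm_inj _ s).
  by rewrite -!gE gkl.
exists (perm gI).
  by rewrite inE; apply/forallP => k /=; rewrite permE gE; exact: H.
apply/permP => k; case: (unliftP ord0 k) => [k'|] ->.
  by rewrite lift_perm_lift permE gE.
by rewrite lift_perm_id.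
Qed.

Lemma fsbig_lt (V : Type) (idx : V) (op : Monoid.com_law idx) (B : nat)
    (F : nat -> V) :
  (forall j, (B <= j)%N -> F j = idx) ->
  \big[op/idx]_(j \in [set: nat]) F j = \big[op/idx]_(j < B) F j.
Proof.
move=> F0; rewrite (fsbigE (iota 0 B)) ?iota_uniq //.
  rewrite -(big_mkord xpredT F) /index_iota subn0.
  by apply: eq_bigl => j; rewrite in_setT.
by move=> j _; rewrite mem_iota add0n -leqNgt => /F0.
Qed.

Lemma card_fiber_gt (N : nat) (a : 'I_N -> nat) (j : nat) :
  (\max_(k < N) a k < j)%N -> #|[pred k | a k == j]| = 0%N.
Proof.
move=> lt_j; apply: eq_card0 => k; rewrite inE.
by apply/negbTE; rewrite neq_ltn (leq_ltn_trans _ lt_j) ?leq_bigmax.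
Qed.

(** The [iter] form serves every commutative monoid: powers in products, multiples in sums. *)
Lemma fsbig_fiber (V : Type) (idx : V) (op : Monoid.com_law idx) (N : nat)
    (a : 'I_N -> nat) (E : nat -> V) :
  \big[op/idx]_(j \in [set: nat]) iter #|[pred k | a k == j]| (op (E j)) idx =
  \big[op/idx]_(k < N) E (a k).
Proof.
rewrite (@fsbig_lt _ _ _ (\max_(k < N) a k).+1) => [|j lt_j]; last first.
  by rewrite card_fiber_gt.
have aB (k : 'I_N) : (a k < (\max_(k < N) a k).+1)%N by rewrite ltnS leq_bigmax.
rewrite [RHS](partition_big (fun k => Ordinal (aB k)) predT) //.
apply: eq_bigr => j _; rewrite -big_const; apply: eq_big => k.
  by rewrite inE -val_eqE.
by rewrite inE => /eqP ->.
Qed.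

Lemma exists_labelling (N : nat) (x : nat -> nat) :
    (0 < N)%N -> \big[addn/0%N]_(j \in [set: nat]) x j = N ->
  exists a : 'I_N -> nat, forall j, #|[pred k | a k == j]| = x j.
Proof.
move=> N_gt0 sumx.
have [B xB] : exists B, forall j, (B <= j)%N -> x j = 0%N.
  have [fin|inf] := pselect (finite_set ([set: nat] `&` x @^-1` [set~ 0%N])).
    have [X XE] := (finite_seqP _).1 fin; exists (\max_(i <- X) i).+1 => j lt_j.
    apply: contrapT => /eqP xj; suff : j \in X.
      by move=> Xj; have := @leq_bigmax_seq _ X xpredT id j Xj isT; rewrite leqNgt lt_j.
    suff : [set` X] j by [].
    by rewrite -XE; split => //=; exact/eqP.
  (* With infinite support the sum would take its default value 0, against [N_gt0]. *)
  by move: N_gt0; rewrite -sumx (fsbig_dflt _ inf).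
rewrite (fsbig_lt _ xB) in sumx.
(* The labelling reads off the list in which each [j] is repeated [x j] times. *)
pose s := flatten [seq nseq (x j) j | j <- iota 0 B].
have size_s : size s = N.
  rewrite size_flatten /shape -map_comp sumnE big_map -sumx.
  rewrite -(big_mkord xpredT x) /index_iota subn0.
  by apply: eq_bigr => j _; rewrite /= size_nseq.
exists (fun k => nth 0%N s k) => j.
rewrite card_fiber_sum -size_s.
rewrite -(big_mkord xpredT (fun k => nat_of_bool (nth 0%N s k == j))).
rewrite -(big_nth 0%N xpredT (fun y => nat_of_bool (y == j))) -big_mkcond sum1_count.
rewrite count_flatten -map_comp sumnE big_map.
under eq_bigr do rewrite /= count_nseq.
have [jB|jB] := ltnP j B; last first.
  rewrite xB // big1_seq // => i /andP[_]; rewrite mem_iota => /andP[_ iB].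
  by rewrite /= (ltn_eqF (leq_trans iB jB)).
rewrite (bigD1_seq j) ?mem_iota ?iota_uniq //= eqxx mul1n big1 ?addn0 // => i.
by move=> /negbTE ->.
Qed.

(** * Coefficients of multivariate polynomials *)

Lemma mcoeff_pihomog (R : nzRingType) (n d : nat) (p : mpoly.mpoly n R) m :
  mpoly.mcoeff m (mpoly.pihomog mpoly.mdeg d p) =
  if mpoly.mdeg m == d then mpoly.mcoeff m p else 0.
Proof.
rewrite mpoly.pihomogE raddf_sum /=.
under eq_bigr do rewrite mpoly.mcoeffZ mpoly.mcoeffX.
case: ifPn => [md|md].
  have [mp|mp] := boolP (m \in mpoly.msupp p).
    rewrite big_mkcond (bigD1_seq m) ?mpoly.msupp_uniq //= md eqxx mulr1.
    by rewrite big1 ?addr0 // => i /negbTE ->; rewrite mulr0 if_same.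
  rewrite (mpoly.memN_msupp_eq0 mp) big1_seq // => i /andP[_ ip].
  case: eqP => [e|_]; last by rewrite mulr0.
  by rewrite -e ip in mp.
rewrite big1 // => i id; case: eqP => [e|_]; last by rewrite mulr0.
by rewrite -e id in md.
Qed.

Lemma msize_leP (R : nzRingType) (n d : nat) (p : mpoly.mpoly n R) :
  (forall m, (d <= mpoly.mdeg m)%N -> mpoly.mcoeff m p = 0) ->
  (mpoly.mmeasure mpoly.mdeg p <= d)%N.
Proof.
move=> H; rewrite mpoly.msizeE; apply/bigmax_leqP_seq => m mp _.
rewrite ltnNge; apply: contraTN mp => /H.
by rewrite mpoly.mcoeff_msupp => ->; rewrite eqxx.
Qed.

(** Only coefficients in degrees at least [d] matter: beyond [d] they vanish with those of [q], and
    a nonzero coefficient of [q] shows that degree [d] is attained. *)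
Lemma leading_form_mcoeff (R : realType) (n d : nat) (c : R)
    (p q : mpoly.mpoly n R) :
    c != 0 -> q != 0 ->
    (forall m, mpoly.mdeg m != d -> mpoly.mcoeff m q = 0) ->
    (forall m, (d <= mpoly.mdeg m)%N ->
       mpoly.mcoeff m p = c * mpoly.mcoeff m q) ->
  leading_form d p q.
Proof.
move=> c0 q0 qd pq; split; last first.
  exists c => //; apply/mpoly.mpolyP => m; rewrite mcoeff_pihomog mpoly.mcoeffZ.
  by case: eqP => [md|/eqP md]; [rewrite pq ?md | rewrite qd ?mulr0].
apply/eqP; rewrite eqn_leq; apply/andP; split.
  by apply: msize_leP => m dm; rewrite pq ?(ltnW dm) // qd ?mulr0 // gtn_eqF.
have [m qm] : exists m, mpoly.mcoeff m q != 0.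
  apply: contrapT => H; case/eqP: q0; apply/mpoly.mpolyP => m.
  by rewrite mpoly.mcoeff0; apply: contrapT => /eqP qm; apply: H; exists m.
have md : mpoly.mdeg m = d.
  by apply/eqP; apply: contraNT qm => /qd ->.
by rewrite -{1}md mpoly.msize_mdeg_lt // mpoly.mcoeff_msupp pq ?md // mulf_neq0.
Qed.

Lemma leq_mnm_mdeg (n : nat) (m : mpoly.multinom n) (k : 'I_n) :
  (m k <= mpoly.mdeg m)%N.
Proof. by rewrite mpoly.mdegE (bigD1 k) //= leq_addr. Qed.

(** * Univariate polynomials in one of the variables *)

Definition poly_at (R : realType) (N : nat) (k : 'I_N) (p : {poly R}) :
  mpoly.mpoly N R := \sum_(i < size p) p`_i *: mpoly_var k ^+ i.

Section PolyAt.
Context {R : realType} {N : nat}.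
Implicit Types (k : 'I_N) (p : {poly R}).

Lemma poly_at_widen k p (B : nat) : (size p <= B)%N ->
  poly_at k p = \sum_(i < B) p`_i *: mpoly_var k ^+ i.
Proof.
move=> pB; rewrite /poly_at (big_ord_widen _ (fun i => p`_i *: mpoly_var k ^+ i) pB).
rewrite big_mkcond; apply: eq_bigr => i _; case: ltnP => // ip.
by rewrite nth_default // scale0r.
Qed.

Lemma meval_poly_at (z : 'I_N -> R) k p : mpoly.meval z (poly_at k p) = p.[z k].
Proof.
rewrite raddf_sum horner_coef; apply: eq_bigr => i _ /=.
by rewrite mpoly.mevalZ rmorphXn /= mpoly.mevalXU.
Qed.

(** The factors involve distinct variables, so exactly one choice of terms, [f0], produces the
    monomial [m]. *)
Lemma mcoeff_prod_poly_at (p : 'I_N -> {poly R}) (m : mpoly.multinom N) :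
  mpoly.mcoeff m (\prod_(k < N) poly_at k (p k)) = \prod_(k < N) (p k)`_(m k).
Proof.
(* A common length for all factors, also large enough for every exponent [m k] to be an index. *)
pose B := maxn (\max_(k < N) size (p k)) (mpoly.mdeg m).+1.
have mB k : (m k < B)%N by rewrite leq_max ltnS leq_mnm_mdeg orbT.
under eq_bigr => k _.
  rewrite (@poly_at_widen _ _ B); last first.
    by rewrite leq_max (leq_bigmax (F := fun k => size (p k))).
  over.
rewrite bigA_distr_bigA /= raddf_sum /=.
pose f0 := [ffun k => Ordinal (mB k)].
have E (f : {ffun 'I_N -> 'I_B}) :
    mpoly.mcoeff m (\prod_(k < N) ((p k)`_(f k) *: mpoly_var k ^+ f k)) =
    (\prod_(k < N) (p k)`_(f k)) * (f == f0)%:R.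
  rewrite scaler_prod mpoly.mcoeffZ; congr (_ * _).
  have -> : \prod_(k < N) mpoly_var k ^+ f k =
      mpoly.mpolyX R (mpoly.Multinom [tuple (f k : nat) | k < N]).
    rewrite mpoly.mpolyXE_id; apply: eq_bigr => k _.
    by rewrite mpoly.multinomE tnth_mktuple.
  rewrite mpoly.mcoeffX; congr (_%:R); congr nat_of_bool.
  apply/eqP/eqP => [e|->].
    apply/ffunP => k; apply: val_inj; rewrite ffunE /= -e.
    by rewrite mpoly.multinomE tnth_mktuple.
  apply/mpoly.mnmP => k; rewrite mpoly.multinomE tnth_mktuple.
  by rewrite ffunE.
under eq_bigr do rewrite E.
rewrite (bigD1 f0) //= eqxx mulr1 [X in _ + X]big1 ?addr0.
  by apply: eq_bigr => k _; rewrite ffunE.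
by move=> f /negbTE ->; rewrite mulr0.
Qed.

End PolyAt.

(** * Symmetrized products of univariate polynomials *)

(** The permanent of the matrix with entries [(p k).[z i]]. *)
Definition sym_prod (R : realType) (N : nat) (p : 'I_N -> {poly R})
    (z : 'I_N -> R) : R := \sum_(s : 'S_N) \prod_(k < N) (p k).[z (s k)].

Section LeadingForm.
Context {R : realType} {N : nat}.
Variables (x : nat -> nat) (a : 'I_N -> nat).
Hypothesis xa : forall j, #|[pred k | a k == j]| = x j.
Let D := (\sum_(k < N) a k)%N.

Lemma fsum_fiber_mul : \big[addn/0%N]_(j \in [set: nat]) (j * x j)%N = D.
Proof.
rewrite /D -(fsbig_fiber _ a id); apply: eq_fsbigr => j _.
by rewrite xa iter_addn_0.
Qed.

Lemma mdeg_fiber (m : mpoly.multinom N) :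
  (forall j, #|[pred k | m k == j]| = x j) -> mpoly.mdeg m = D.
Proof.
move=> mx; rewrite mpoly.mdegE -fsum_fiber_mul -(fsbig_fiber _ _ id).
by apply: eq_fsbigr => j _; rewrite mx iter_addn_0.
Qed.

Lemma mcoeff_monomial_sym (m : mpoly.multinom N) :
  mpoly.mcoeff m (monomial_sym N x : mpoly.mpoly N R) =
  `[< forall j, #|[pred k | m k == j]| = x j >]%:R.
Proof.
rewrite /monomial_sym fsum_fiber_mul raddf_sum /=.
under eq_bigr do rewrite mpoly.mcoeffX.
case: asboolP => [mx|mx]; last first.
  by rewrite big1 // => i /asboolP ix; case: eqP => // im; case: mx; rewrite -im.
(* The degree bound built into [monomial_sym] loses no monomial: those with the prescribed fibers
   all have degree [D]. *)
have mD1 : (mpoly.mdeg m < D.+1)%N by rewrite mdeg_fiber.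
rewrite big_mkcond (bigD1 (mpoly.BMultinom mD1)) //= eqxx asboolT // big1 ?addr0 //.
move=> i; rewrite -val_eqE /= => /negbTE ->.
by rewrite if_same.
Qed.

(** The count is the same for all rearrangements [m] of [a], which makes the top form a scalar
    multiple of [monomial_sym]. *)
Lemma card_perm_fiber (m : mpoly.multinom N) :
  #|[pred s : 'S_N | [forall k, a (s k) == m k]]| =
  (`[< forall j, #|[pred k | m k == j]| = x j >] * \prod_(j < D.+1) (x j)`!)%N.
Proof.
case: asboolP => [mx|mx].
  rewrite mul1n (@card_perm_relabel D.+1) => [|k|j].
  - by apply: eq_bigr => j _; rewrite mx.
  - by rewrite ltnS -(mdeg_fiber mx) leq_mnm_mdeg.
  - by rewrite xa mx.
rewrite eq_card0 // => s; rewrite inE; apply/negbTE/negP => /forallP H.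
apply: mx => j; rewrite -xa -(card_fiber_perm a s); apply: eq_card => k.
by rewrite !inE (eqP (H k)).
Qed.

Variable Q : nat -> {poly R}.
Hypothesis sizeQ : forall j, size (Q j) = j.+1.

(** A nonzero contribution of [s] needs [m k <= a (s k)] for all [k]. The right-hand sides add up to
    [D], at most the degree of [m], so equality holds everywhere and only leading coefficients
    enter. *)
Lemma mcoeff_sym_prod_top (m : mpoly.multinom N) : (D <= mpoly.mdeg m)%N ->
  mpoly.mcoeff m (\sum_(s : 'S_N) \prod_(k < N) poly_at k (Q (a (s k)))) =
  #|[pred s : 'S_N | [forall k, a (s k) == m k]]|%:R *
  \prod_(k < N) lead_coef (Q (a k)).
Proof.
move=> Dm; rewrite raddf_sum /= mulr_natl -sumr_const [RHS]big_mkcond /=.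
apply: eq_bigr => s _; rewrite mcoeff_prod_poly_at inE; case: ifPn => [/forallP H|].
  rewrite [RHS](reindex_inj (@perm_inj _ s)) /=; apply: eq_bigr => k _.
  by rewrite -(eqP (H k)) lead_coefE sizeQ.
rewrite negb_forall => /existsP[k0 k0P].
suff [k lt_k] : exists k, (a (s k) < m k)%N.
  by rewrite (bigD1 k) //= nth_default ?mul0r // sizeQ.
apply: contrapT => H.
have ma k : (m k <= a (s k))%N.
  by rewrite leqNgt; apply/negP => lt_k; apply: H; exists k.
have := @leqif_sum _ predT (fun k => m k == a (s k)) m (a \o s)
  (fun k _ => leqif_eq (ma k)).
have Ds : (\sum_(k < N) a (s k))%N = D.
  by rewrite /D [RHS](reindex_inj (@perm_inj _ s)).
rewrite -mpoly.mdegE /= Ds.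
move=> [le_mD]; rewrite eqn_leq le_mD Dm => /esym/forallP/(_ k0).
by rewrite eq_sym (negbTE k0P).
Qed.

Lemma sym_prod_leading_form : exists G : mpoly.mpoly N R,
  leading_form D G (monomial_sym N x) /\
  forall z, (N`!)%:R^-1 * sym_prod (Q \o a) z = mpoly.meval z G.
Proof.
exists ((N`!)%:R^-1 *: \sum_(s : 'S_N) \prod_(k < N) poly_at k (Q (a (s k)))).
split; last first.
  move=> z; rewrite mpoly.mevalZ raddf_sum; congr (_ * _).
  (* Replacing [s] by its inverse moves the permutation from the labels to the points. *)
  rewrite [RHS](reindex_inj invg_inj); apply: eq_bigr => s _ /=.
  rewrite rmorph_prod /= [RHS](reindex_inj (@perm_inj _ s)).
  by apply: eq_bigr => k _ /=; rewrite meval_poly_at permK.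
pose c := (\prod_(j < D.+1) (x j)`!)%:R * \prod_(k < N) lead_coef (Q (a k)).
apply: (@leading_form_mcoeff _ _ _ ((N`!)%:R^-1 * c)).
- rewrite !mulf_neq0 ?invr_eq0 ?pnatr_eq0 -?lt0n ?fact_gt0 //.
    by rewrite prodn_gt0 // => j; exact: fact_gt0.
  by apply/prodf_neq0 => k _; rewrite lead_coef_eq0 -size_poly_eq0 sizeQ.
- apply/eqP => /mpoly.mpolyP /(_ (mpoly.Multinom [tuple a k | k < N])) /eqP.
  rewrite mcoeff_monomial_sym asboolT ?mpoly.mcoeff0 ?oner_eq0 // => j.
  rewrite -xa; apply: eq_card => k; rewrite !inE.
  by rewrite mpoly.multinomE tnth_mktuple.
- move=> m /eqP mD; rewrite mcoeff_monomial_sym; case: asboolP => // /mdeg_fiber.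
  by move/mD.
move=> m Dm; rewrite mpoly.mcoeffZ mcoeff_sym_prod_top // card_perm_fiber.
by rewrite mcoeff_monomial_sym natrM -!mulrA [_%:R * c]mulrC -!mulrA.
Qed.

End LeadingForm.

(** * The dual Krawtchouk polynomials as symmetrized products *)

Section DualKrawtchouk.
Context {R : realType} {N : nat}.
Variables (u : nat -> nat -> R) (n x : nat -> nat) (a b : 'I_N -> nat).
Hypothesis xa : forall j, #|[pred k | a k == j]| = x j.
Hypothesis nb : forall l, #|[pred k | b k == l]| = n l.
Let L := last_index n.

Lemma label_le_last_index (k : 'I_N) : (b k <= L)%N.
Proof.
rewrite /L /last_index (fsbigE (undup (codom b))) ?undup_uniq //; first last.
- move=> l /= + /negP; rewrite mem_undup -nb => n0 []; move: n0.
  by rewrite -lt0n => /card_gt0P[i]; rewrite inE => /eqP <-; exact: codom_f.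
- move=> l /=; rewrite mem_undup => /codomP[i ->].
  by rewrite -nb -lt0n; apply/card_gt0P; exists i; rewrite inE.
have bk : b k \in undup (codom b) by rewrite mem_undup codom_f.
apply: (@leq_bigmax_seq _ _ _ id _ bk); rewrite inE /=.
by rewrite -nb -lt0n; apply/card_gt0P; exists k; rewrite inE.
Qed.

Lemma gt_last_index (l : nat) : (L < l)%N -> n l = 0%N.
Proof.
move=> Ll; apply/eqP; apply: contraTT Ll; rewrite -nb -lt0n -leqNgt.
by move=> /card_gt0P[k]; rewrite inE => /eqP <-; exact: label_le_last_index.
Qed.

Lemma sum_fiber (B : nat) (f : 'I_N -> nat) : (forall k, (f k < B)%N) ->
  (\sum_(l < B) #|[pred k | f k == l]|)%N = N.
Proof.
move=> fB; rewrite -[RHS]card_ord -[RHS]sum1_card.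
rewrite [RHS](partition_big (fun k => Ordinal (fB k)) predT) //.
apply: eq_bigr => l _; rewrite -sum1_card; apply: eq_bigl => k.
by rewrite inE -val_eqE.
Qed.

(** The map [b \o s] runs through the rearrangements [f] of [b], each reached by as many
    permutations as preserve the fibers of [b]. *)
Lemma sum_perm_labels :
  \sum_(s : 'S_N) \prod_(k < N) u (a k) (b (s k)) =
  (\prod_(l < L.+1) (n l)`!)%:R *
  \sum_(f : {ffun 'I_N -> 'I_L.+1} | [forall l : 'I_L,
     #|[pred k | f k == l.+1 :> nat]| == n l.+1]) \prod_(k < N) u (a k) (f k).
Proof.
have bL k : (b k < L.+1)%N by rewrite ltnS label_le_last_index.
rewrite (partition_big (fun s : 'S_N => [ffun k => Ordinal (bL (s k))]) predT) //=.
rewrite big_distrr [RHS]big_mkcond; apply: eq_bigr => f _ /=.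
transitivity (#|[pred s : 'S_N | [forall k, b (s k) == f k]]|%:R *
    \prod_(k < N) u (a k) (f k)).
  rewrite mulr_natl -sumr_const; apply: eq_big => s.
    rewrite inE; apply/eqP/forallP => [<- k|H]; first by rewrite ffunE.
    by apply/ffunP => k; apply: val_inj; rewrite ffunE /= (eqP (H k)).
  by move=> /eqP <-; apply: eq_bigr => k _; rewrite ffunE.
case: ifPn => [/forallP H|].
  have fnS j : (j < L)%N -> #|[pred k | f k == j.+1 :> nat]| = n j.+1.
    by move=> jL; exact: eqP (H (Ordinal jL)).
  (* The condition on [f] omits the label 0, which has no variable; its fiber is determined because
     all fibers together have [N] slots. *)
  have fn0 : #|[pred k | f k == 0 :> nat]| = n 0%N.
    have := sum_fiber (fun k => ltn_ord (f k)); rewrite -[RHS](sum_fiber bL).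
    rewrite !big_ord_recl nb /=; under eq_bigr do rewrite fnS //.
    under [X in _ = (_ + X)%N]eq_bigr do rewrite nb.
    exact: addIn.
  have fn j : #|[pred k | f k == j :> nat]| = n j.
    have [Lj|] := ltnP L j; last by case: j => // j; exact: fnS.
    rewrite gt_last_index // eq_card0 // => k; rewrite inE.
    by rewrite ltn_eqF // (leq_trans (ltn_ord _) Lj).
  rewrite (@card_perm_relabel L.+1 N b (fun k => f k)) => [|k|j]; last by rewrite nb fn.
    by congr (_%:R * _); apply: eq_bigr => j _; rewrite fn.
  exact: ltn_ord.
move=> nH; rewrite eq_card0 ?mul0r // => s; rewrite inE.
apply/negbTE; apply: contra nH => /forallP H; apply/forallP => l.
rewrite -nb -(card_fiber_perm b s); apply/eqP/eq_card => k.
by rewrite !inE (eqP (H k)).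
Qed.

(** With one factor per slot, expanding the generating function means choosing a label [f k] in each
    slot; the exponent of each variable counts the slots with that label. *)
Lemma krawtchoukE : krawtchouk u n x =
  \sum_(f : {ffun 'I_N -> 'I_L.+1} | [forall l : 'I_L,
     #|[pred k | f k == l.+1 :> nat]| == n l.+1]) \prod_(k < N) u (a k) (f k).
Proof.
(* Homogenization: the variable w_0 is set to 1. *)
pose W (l : 'I_L.+1) : mpoly.mpoly L R :=
  if unlift ord0 l is Some i then mpoly_var i else 1.
have -> : krawtchouk u n x = mpoly.mcoeff (mnm_shift L n)
    (\prod_(k < N) \sum_(l < L.+1) u (a k) l *: W l).
  rewrite /krawtchouk /krawtchouk_gf -/L; congr mpoly.mcoeff.
  rewrite -(fsbig_fiber _ a (fun j => \sum_(l < L.+1) u j l *: W l)).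
  apply: eq_fsbigr => j _; rewrite xa iter_mulr_1 big_ord_recl; congr ((_ + _) ^+ _).
    by rewrite /W unlift_none -mpoly.alg_mpolyC.
  by apply: eq_bigr => l _; rewrite /W liftK lift0.
rewrite bigA_distr_bigA raddf_sum /= [RHS]big_mkcond; apply: eq_bigr => f _ /=.
rewrite scaler_prod mpoly.mcoeffZ.
have -> : \prod_(k < N) W (f k) =
    mpoly.mpolyX R (mnm_shift L (fun l => #|[pred k | f k == l :> nat]|)).
  rewrite mpoly.mpolyXE_id (partition_big f predT) //= big_ord_recl.
  rewrite big1 ?mul1r; last by move=> k /eqP ->; rewrite /W unlift_none.
  apply: eq_bigr => l _; rewrite mpoly.multinomE tnth_mktuple -prodr_const.
  apply: eq_big => k; first by rewrite inE -val_eqE.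
  by move=> /eqP ->; rewrite /W liftK.
rewrite mpoly.mcoeffX; case: ifPn => [/forallP H|nH].
  rewrite (_ : mnm_shift L _ = mnm_shift L n) ?eqxx ?mulr1 //.
  by apply/mpoly.mnmP => l; rewrite !mpoly.multinomE !tnth_mktuple (eqP (H l)).
case: eqP => [/mpoly.mnmP H|]; last by rewrite mulr0.
case/negP: nH; apply/forallP => l; apply/eqP.
by have := H l; rewrite !mpoly.multinomE !tnth_mktuple.
Qed.

(** The factorials in the inverse multinomial coefficient are exactly the multiplicity with which
    permutations reach each map. *)
Lemma dual_krawtchoukE : dual_krawtchouk u n x N =
  (N`!)%:R^-1 * \sum_(s : 'S_N) \prod_(k < N) u (a k) (b (s k)).
Proof.
rewrite sum_perm_labels -krawtchoukE /dual_krawtchouk /multinomial_coef.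
rewrite (@fsbig_lt _ _ _ L.+1) => [|l /gt_last_index ->//].
by rewrite invf_div mulrCA mulrA.
Qed.

End DualKrawtchouk.

(** * Reduction to power sums *)

Section SymProd.
Context {R : realType} {N : nat}.
Implicit Types (p : 'I_N -> {poly R}) (z : 'I_N -> R) (k : 'I_N) (q : {poly R}).

Definition update (T : Type) (p : 'I_N -> T) k (q : T) (i : 'I_N) : T :=
  if i == k then q else p i.

Lemma eq_sym_prod p p' z : p =1 p' -> sym_prod p z = sym_prod p' z.
Proof. by move=> pp; apply: eq_bigr => s _; apply: eq_bigr => k _; rewrite pp. Qed.

Lemma sym_prod_perm (t : 'S_N) p z : sym_prod (p \o t) z = sym_prod p z.
Proof.
rewrite [RHS](reindex_inj (mulgI t^-1%g)); apply: eq_bigr => s _ /=.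
rewrite [RHS](reindex_inj (@perm_inj _ t)); apply: eq_bigr => k _ /=.
by rewrite permM permK.
Qed.

(** In the term of [s], each point is [z (s k)] for one slot [k], so each summand of the power sum
    joins the factor of that slot. *)
Lemma power_sum_sym_prod p q z :
  (\sum_(k < N) q.[z k]) * sym_prod p z =
  \sum_(k < N) sym_prod (update p k (q * p k)) z.
Proof.
rewrite exchange_big big_distrr /=; apply: eq_bigr => s _.
rewrite (reindex_inj (@perm_inj _ s)) big_distrl /=; apply: eq_bigr => k _.
rewrite (bigD1 k) //= [RHS](bigD1 k) //= /update eqxx hornerM -mulrA; congr (_ * (_ * _)).
by apply: eq_bigr => i /negbTE ->.
Qed.

Lemma power_sum_sym_prod_slots (A : {set 'I_N}) (k0 : 'I_N) p q z :
    k0 \notin A -> (forall k, k \notin A -> p k = 1) ->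
  (\sum_(k < N) q.[z k]) * sym_prod p z =
  \sum_(k in A) sym_prod (update p k (q * p k)) z +
  (N - #|A|)%:R * sym_prod (update p k0 q) z.
Proof.
move=> k0A p1; rewrite power_sum_sym_prod (bigID (mem A)) /=; congr (_ + _).
rewrite (_ : (N - #|A|)%N = #|~: A|); last by rewrite [RHS]cardsCs finset.setCK card_ord.
rewrite mulr_natl -sumr_const; apply: eq_big => [k|k kA]; first by rewrite inE.
(* All slots outside [A] carry 1, so transposing [k] and [k0] moves [q] to [k0] without changing the
   symmetrized product. *)
rewrite p1 // mulr1 -(sym_prod_perm (tperm k k0)); apply: eq_sym_prod => i /=.
rewrite /update; case: tpermP => [->|->|/eqP/negbTE -> /eqP/negbTE ->] //.
  by rewrite eq_sym; case: eqP => // _; rewrite !p1.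
by rewrite !eqxx.
Qed.

End SymProd.

(** * Degree bounds for multivariate polynomials *)

Section MpolySize.
Context {R : idomainType} {n : nat}.
Implicit Types (p q : mpoly.mpoly n R).
Local Notation msize := (mpoly.mmeasure mpoly.mdeg).

Lemma msizeM_leq p q : (msize (p * q) <= (msize p + msize q).-1)%N.
Proof.
have [->|p0] := eqVneq p 0; first by rewrite mul0r mpoly.msize0.
have [->|q0] := eqVneq q 0; first by rewrite mulr0 mpoly.msize0.
by rewrite mpoly.msizeM.
Qed.

Lemma msizeB_leq d p q :
  (msize p <= d)%N -> (msize q <= d)%N -> (msize (p - q) <= d)%N.
Proof.
move=> pd qd; apply: leq_trans (mpoly.msizeD_le _ _) _.
by rewrite mpoly.msizeN geq_max pd.
Qed.

(** [msize] of a nonzero polynomial is its total degree plus one, so size at most 2 means degree at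
    most one. *)
Lemma msize_prod_linear (I : finType) (A : {set I}) (l : I -> mpoly.mpoly n R) :
  (forall k, k \in A -> (msize (l k) <= 2)%N) ->
  (msize (\prod_(k in A) l k) <= #|A|.+1)%N.
Proof.
move=> lA; rewrite -sum1_card.
elim/big_ind2: _ => [|d p e q pd qe|k /lA //]; first by rewrite mpoly.msize1.
apply: leq_trans (msizeM_leq _ _) _.
rewrite -ltnS; case: (_ + _)%N (leq_add pd qe) => //= s.
by rewrite addSn addnS.
Qed.

End MpolySize.

(** * Symmetrized products as polynomials in power sums *)

Section PowerSums.
Context {R : realType} {N M : nat}.
Variable Q : nat -> {poly R}.
Hypothesis sizeQ : forall j, size (Q j) = j.+1.
Hypothesis Q0 : Q 0%N = 1.
Local Notation msize := (mpoly.mmeasure mpoly.mdeg).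

Definition power_sums (z : 'I_N -> R) (i : 'I_M) : R := \sum_(k < N) (Q i.+1).[z k].

(** Affine rather than homogeneous: the component of [q] along [Q 0 = 1] contributes a constant
    multiple of [N]. *)
Definition linear_power_sum (l : mpoly.mpoly M R) (q : {poly R}) : Prop :=
  (msize l <= 2)%N /\
  forall z, mpoly.meval (power_sums z) l = \sum_(k < N) q.[z k].

(** Expansion of [q] in the basis [Q 0], ..., [Q M], removing one leading term at a time. *)
Lemma exists_linear_power_sum (q : {poly R}) : (size q <= M.+1)%N ->
  exists l, linear_power_sum l q.
Proof.
suff H n : (n <= M.+1)%N -> forall q : {poly R}, (size q <= n)%N ->
    exists l, linear_power_sum l q.
  exact: H.
elim: n => [|n IH] nM {}q.
  rewrite leqn0 size_poly_eq0 => /eqP ->; exists 0; split.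
    by rewrite mpoly.msize0.
  by move=> z; rewrite mpoly.meval0 big1 // => k _; rewrite horner0.
move=> /leq_sizeP qn; pose b := q`_n / lead_coef (Q n).
have Qn : lead_coef (Q n) != 0 by rewrite lead_coef_eq0 -size_poly_eq0 sizeQ.
have [||l [l2 lq]] := IH _ (q - b *: Q n).
- exact: ltnW.
- apply/leq_sizeP => j; rewrite leq_eqVlt => /predU1P[<-|nj].
    rewrite coefB coefZ -[(Q n)`_n]/((Q n)`_n.+1.-1) -(sizeQ n) -lead_coefE.
    by rewrite divfK ?subrr.
  by rewrite coefB coefZ qn // nth_default ?sizeQ // mulr0 subr0.
have [l' [l'2 lQ]] : exists l, linear_power_sum l (Q n).
  case: n nM {IH qn b Qn lq} => [|n] nM.
    exists (mpoly.mpolyC M N%:R); split.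
      by rewrite mpoly.msizeC; case: (_ != _).
    move=> z; rewrite mpoly.mevalC Q0; under eq_bigr do rewrite hornerC.
    by rewrite sumr_const card_ord.
  exists (mpoly_var (Ordinal (nM : (n < M)%N))); split.
    by rewrite mpoly.msizeX mpoly.mdeg1.
  by move=> z; rewrite mpoly.mevalXU.
exists (l + b *: l'); split.
  apply: leq_trans (mpoly.msizeD_le _ _) _; rewrite geq_max l2.
  exact: leq_trans (mpoly.msizeZ_le _ _) l'2.
move=> z; rewrite mpoly.mevalD mpoly.mevalZ lq lQ big_distrr -big_split /=.
by apply: eq_bigr => k _; rewrite hornerD hornerN hornerZ subrK.
Qed.

(* A is the set of filled slots: p k = 1 outside A.  Each filled slot contributes
   a linear factor l k, and there are (N - #|A|)! ways to place the others. *)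
Lemma sym_prod_power_sums (A : {set 'I_N}) (p : 'I_N -> {poly R})
    (l : 'I_N -> mpoly.mpoly M R) :
    (forall k, k \notin A -> p k = 1) ->
    (\sum_(k in A) (size (p k)).-1 <= M)%N ->
    (forall k, k \in A -> linear_power_sum (l k) (p k)) ->
  exists F : mpoly.mpoly M R,
    (forall z, sym_prod p z = mpoly.meval (power_sums z) F) /\
    (msize (F - ((N - #|A|)`!)%:R *: \prod_(k in A) l k) <= #|A|)%N.
Proof.
have [m] := ubnP #|A|; elim: m A p l => // m IH A p l.
(* With no filled slot, each of the [N!] products is 1. Otherwise a filled slot [k0] is emptied,
   giving [A'] and [p']. *)
have [->|/set0Pn[k0 k0A]] := eqVneq A finset.set0.
  rewrite cards0 subn0 => _ p1 _ _; exists (mpoly.mpolyC M (N`!)%:R); split.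
    move=> z; rewrite mpoly.mevalC -[in RHS](card_Sn N) -sumr_const.
    apply: eq_big => s; first by rewrite inE.
    by rewrite big1 // => k _; rewrite p1 ?inE // hornerC.
  by rewrite big_set0 -mpoly.alg_mpolyC subrr mpoly.msize0.
have cA := cardsD1 k0 A; rewrite k0A add1n in cA.
rewrite cA ltnS => Am p1 degp lp; set A' := (A :\ k0)%SET in cA Am *.
pose r := (N - #|A'|)%N.
have rE : r = (N - #|A'|.+1).+1.
  by rewrite /r subnSK // -cA -[X in (_ <= X)%N]card_ord max_card.
have r_neq0 : r%:R != 0 :> R by rewrite pnatr_eq0 rE.
have A'A k : k \in A' -> k \in A by rewrite !inE => /andP[].
have k0A' : k0 \notin A' by rewrite !inE eqxx.
have degp' : (\sum_(k in A') (size (p k)).-1 + (size (p k0)).-1 <= M)%N.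
  move: degp; rewrite (big_setD1 k0) //= addnC.
  by apply: leq_trans.
pose p' := update p k0 1.
have p'1 k : k \notin A' -> p' k = 1.
  by rewrite /p' /update !inE negb_and negbK; case: eqP => //= _; exact: p1.
have p'E k : k \in A' -> p' k = p k.
  by rewrite /p' /update !inE => /andP[/negbTE ->].
have [||||F' [F'E F'size]] := IH A' p' l.
- exact: Am.
- exact: p'1.
- rewrite (eq_bigr (fun k => (size (p k)).-1)); last by move=> k /p'E ->.
  exact: leq_trans (leq_addr _ _) degp'.
- by move=> k kA'; rewrite p'E //; exact/lp/A'A.
have /choice[Fk FkP] : forall k, exists F : mpoly.mpoly M R, k \in A' ->
    (forall z, sym_prod (update p' k (p k0 * p' k)) z =
               mpoly.meval (power_sums z) F) /\ (msize F <= #|A'|.+1)%N.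
  move=> k; have [kA'|] := boolP (k \in A'); last by exists 0.
  have deg_mul : ((size (p k0 * p' k)%R).-1 <= (size (p k0)).-1 + (size (p k)).-1)%N.
    rewrite p'E //; have [->|p0] := eqVneq (p k0) 0%R; first by rewrite mul0r size_poly0.
    have [->|pk] := eqVneq (p k) 0%R; first by rewrite mulr0 size_poly0.
    rewrite size_mul //; move: p0 pk; rewrite -!size_poly_gt0.
    by do 2!case: size => // ?; rewrite !addSn addnS.
  have degA' : (\sum_(i in A') (size (p i)).-1 =
      (size (p k)).-1 + \sum_(i in A' | i != k) (size (p i)).-1)%N.
    by rewrite (bigD1 k).
  (* The bound by [M] on the sum of all degrees keeps the product within the span of [Q 0], ...,
     [Q M]. *)
  have [|l' l'P] := @exists_linear_power_sum (p k0 * p' k).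
    apply: leq_trans (leqSpred _) _; rewrite ltnS; apply: leq_trans deg_mul _.
    apply: leq_trans degp'; rewrite degA' addnC leq_add2r.
    exact: leq_addr.
  have [||||F [FE Fsize]] := IH A' (update p' k (p k0 * p' k)) (update l k l').
  - exact: Am.
  - move=> i iA'; rewrite /update; case: eqP => [ik|_]; last exact: p'1.
    by rewrite ik kA' in iA'.
  - apply: leq_trans degp'; rewrite (bigD1 k) //= /update eqxx degA'.
    rewrite (eq_bigr (fun i => (size (p i)).-1)).
      by rewrite addnAC leq_add2r addnC.
    by move=> i /andP[iA' /negbTE ->]; rewrite -/(update _ _ _) p'E.
  - move=> i iA'; rewrite /update; case: eqP => // _.
    by rewrite p'E //; exact/lp/A'A.
  exists F => _; split=> //.
  rewrite -[F](subrK (((N - #|A'|)`!)%:R *: \prod_(i in A') update l k l' i)).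
  apply: leq_trans (mpoly.msizeD_le _ _) _; rewrite geq_max (leq_trans Fsize) //=.
  apply: leq_trans (mpoly.msizeZ_le _ _) _; apply: msize_prod_linear => i iA'.
  by rewrite /update; case: eqP => _; [exact: l'P.1 | exact: (lp _ (A'A _ iA')).1].
(* The identity of [power_sum_sym_prod_slots] for [p'] and [p k0], solved for [sym_prod p]; [r]
   counts the empty slots of [p']. *)
exists (r%:R^-1 *: (l k0 * F' - \sum_(k in A') Fk k)); split.
  move=> z; rewrite mpoly.mevalZ mpoly.mevalB mpoly.mevalM (raddf_sum (mpoly.meval _)) /=.
  rewrite (lp _ k0A).2 -F'E (@power_sum_sym_prod_slots _ _ A' k0) //.
  rewrite (eq_bigr (fun k => mpoly.meval (power_sums z) (Fk k))); last first.
    by move=> k /FkP[].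
  rewrite addrAC subrr add0r mulKf //; apply: eq_sym_prod => i.
  by rewrite /p' /update; case: eqP => // ->.
(* Since [r!] is [r] times [(N - #|A|)!], the leading product is [l k0] times the one for [A'],
   divided by [r]. *)
have -> : r%:R^-1 *: (l k0 * F' - \sum_(k in A') Fk k) -
    ((N - #|A'|.+1)`!)%:R *: \prod_(k in A) l k =
    r%:R^-1 *: (l k0 * (F' - (r`!)%:R *: \prod_(k in A') l k) - \sum_(k in A') Fk k).
  rewrite (big_setD1 k0 k0A) /= -/A' mulrBr -scalerAr [in RHS]addrAC [RHS]scalerBr.
  by rewrite scalerA rE factS natrM mulKf // -rE.
apply: leq_trans (mpoly.msizeZ_le _ _) _; apply: msizeB_leq.
  apply: leq_trans (msizeM_leq _ _) _.
  have := leq_add (lp _ k0A).1 F'size; rewrite -/r add2n.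
  by case: (_ + _)%N.
apply: leq_trans (mpoly.msize_sum _ _ _) _; apply/bigmax_leqP => k kA'.
by case: (FkP k kA').
Qed.

End PowerSums.

(** * The birth and death setting *)

(** The recurrence solved for [Q n.+1] has the dominant term [- 'X * Q n] divided by [lam n], which
    is nonzero; two consecutive sizes are carried through the induction. *)
Lemma size_spectral_polynomials (R : realType) (lam mu : nat -> R)
    (Q : nat -> {poly R}) :
    (forall i, 0 < lam i) -> spectral_polynomials lam mu Q ->
  forall j, size (Q j) = j.+1.
Proof.
move=> lam_gt0 [Q0 Qrec].
have sizeS n : size (Q n) = n.+1 -> (if n is m.+1 then size (Q m) = n else True) ->
    size (Q n.+1) = n.+2.
  move=> Qn Qm; have lam_neq0 : lam n != 0 by rewrite gt_eqF.
  pose q := (lam n + mu n) *: Q n - mu n *: (if n is m.+1 then Q m else 0).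
  have -> : Q n.+1 = (lam n)^-1 *: (q - 'X * Q n).
    rewrite Qrec /q -[X in _ *: (_ + X)]addrA addrACA subrr add0r.
    by rewrite [- _ + _]addrC addrK scalerK.
  have Qn_neq0 : Q n != 0 by rewrite -size_poly_eq0 Qn.
  rewrite size_scale ?invr_eq0 // addrC.
  rewrite size_polyDl size_polyN -commr_polyX size_mulX ?Qn //.
  rewrite ltnS; apply: leq_trans (size_polyD _ _) _; rewrite geq_max size_polyN.
  rewrite (leq_trans (size_scale_leq _ _)) ?Qn //.
  rewrite (leq_trans (size_scale_leq _ _)) //.
  by case: n Qm {Qn lam_neq0 Qn_neq0 q} => [_|m ->//]; rewrite size_poly0.
suff H j : size (Q j) = j.+1 /\ size (Q j.+1) = j.+2 by move=> j; case: (H j).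
elim: j => [|j [Qj QSj]]; last by split=> //; apply: sizeS.
have s0 : size (Q 0%N) = 1%N by rewrite Q0 size_poly1.
by split=> //; apply: sizeS.
Qed.

Lemma fsum_pos_labels (N : nat) (x : nat -> nat) (a : 'I_N -> nat) :
    (forall j, #|[pred k | a k == j]| = x j) ->
  \big[addn/0%N]_(j \in [set: nat]) ((j != 0) * x j)%N =
  #|[set k | a k != 0%N]%SET|.
Proof.
move=> xa; rewrite -sum1_card [RHS]big_mkcond.
rewrite [RHS](eq_bigr (fun k => nat_of_bool (a k != 0%N))).
  rewrite -[RHS](fsbig_fiber _ _ (fun j => nat_of_bool (j != 0%N))).
  by apply: eq_fsbigr => j _; rewrite xa iter_addn_0.
by move=> k _; rewrite inE; case: (_ == _).
Qed.

(** As [Q 0 = 1], the filled slots are those with nonzero label, each contributing one variable. [M]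
    bounds every label and also the degree of every product of factors from distinct slots. *)
Lemma sym_prod_leading_power_sums (R : realType) (N : nat) (x : nat -> nat)
    (a : 'I_N -> nat) (Q : nat -> {poly R}) :
    (forall j, #|[pred k | a k == j]| = x j) ->
    (forall j, size (Q j) = j.+1) -> Q 0%N = 1 ->
  let M := (\sum_(k < N) a k)%N in
  exists F : mpoly.mpoly M R,
    leading_form #|[set k | a k != 0%N]%SET| F (mpoly.mpolyX R (mnm_shift M x)) /\
    forall z, (N`!)%:R^-1 * sym_prod (Q \o a) z =
              mpoly.meval (power_sums Q z) F.
Proof.
move=> xa sizeQ Q0 M; set A := [set k | a k != 0%N]%SET.
have aM k : (a k < M.+1)%N by rewrite ltnS /M (bigD1 k) //= leq_addr.
have xM j : (M < j)%N -> x j = 0%N.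
  move=> Mj; rewrite -xa card_fiber_gt //; apply: leq_ltn_trans Mj.
  by apply/bigmax_leqP => k _; rewrite -ltnS.
(* [E j] is the variable standing for the power sum of [Q j]; the value 0 concerns only [j > M],
   which labels no slot. *)
pose E (j : nat) : mpoly.mpoly M R :=
  if j is i.+1 then if insub i is Some i' then mpoly_var i' else 0 else 1.
have EA : \prod_(k in A) E (a k) = mpoly.mpolyX R (mnm_shift M x).
  rewrite big_mkcond (eq_bigr (fun k => E (a k))); last first.
    by move=> k _; rewrite inE; case: (a k).
  rewrite -fsbig_fiber (@fsbig_lt _ _ _ M.+1) => [|j /xM]; last first.
    by rewrite xa => ->.
  rewrite big_ord_recl /= iter_mulr_1 expr1n mul1r mpoly.mpolyXE_id.
  apply: eq_bigr => i _; rewrite iter_mulr_1 xa mpoly.multinomE tnth_mktuple /=.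
  by rewrite /bump /= valK.
have AN : (#|A| <= N)%N by rewrite -[leqRHS]card_ord max_card.
have [|||F [FE Fsize]] := @sym_prod_power_sums R N M Q sizeQ Q0 A (Q \o a) (E \o a).
- by move=> k; rewrite inE negbK /= => /eqP ->.
- rewrite [leqRHS](bigID (mem A)) /= -[leqLHS]addn0 leq_add //.
  by rewrite leq_sum // => k _; rewrite sizeQ.
- move=> k; rewrite inE /=; case: (a k) (aM k) => // i iM _.
  rewrite /E insubT; split; first by rewrite mpoly.msizeX mpoly.mdeg1.
  by move=> z; rewrite mpoly.mevalXU.
exists ((N`!)%:R^-1 *: F); split; last by move=> z; rewrite mpoly.mevalZ FE.
have mdegA : mpoly.mdeg (mnm_shift M x) = #|A|.
  rewrite -(fsum_pos_labels xa) (@fsbig_lt _ _ _ M.+1) => [|j /xM ->]; last first.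
    by rewrite muln0.
  rewrite big_ord_recl [RHS]add0n mpoly.mdegE; apply: eq_bigr => i _.
  by rewrite mpoly.multinomE tnth_mktuple mul1n.
rewrite /= EA in Fsize.
apply: (@leading_form_mcoeff _ _ _ ((N`!)%:R^-1 * ((N - #|A|)`!)%:R)).
- by rewrite mulf_neq0 ?invr_eq0 ?pnatr_eq0 -?lt0n ?fact_gt0.
- by rewrite -mpoly.msize_poly_eq0 mpoly.msizeX.
- move=> m; apply: contraNeq; rewrite mpoly.mcoeffX pnatr_eq0 eqb0 negbK => /eqP <-.
  by rewrite mdegA.
move=> m Am; rewrite mpoly.mcoeffZ -mulrA; congr (_ * _).
apply/eqP; rewrite -subr_eq0 -mpoly.mcoeffZ -mpoly.mcoeffB mpoly.mcoeff_eq0.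
exact/mpoly.msize_mdeg_ge/(leq_trans Fsize).
Qed.

(** The support is a countable union of points, hence measurable; each of the finitely many [Z k]
    leaves it with probability zero. *)
Lemma ae_range (R : realType) (psi : probability R R) (zeta : nat -> R)
    (N : nat) (dT : measure_display) (T : measurableType dT)
    (P : probability T R) (Z : 'I_N -> {RV P >-> R}) :
    psi (~` range zeta) = 0%E -> iid_rvs Z psi ->
  {ae P, forall w, forall k, exists l, Z k w = zeta l}.
Proof.
move=> psi0 [_ ZP]; apply: filter_forall => k.
have mrange : measurable (range zeta).
  rewrite (_ : range zeta = \bigcup_l [set zeta l]).
    by apply: bigcup_measurable => l _; exact: measurable_set1.
  by apply/seteqP; split => [y [l _ <-]|y [l _ ->]]; exists l.
exists (Z k @^-1` (~` range zeta)); split.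
- by rewrite -[X in measurable X]setTI; apply: measurable_funP => //; exact: measurableC.
- have := ZP k _ (measurableC mrange); rewrite psi0; exact.
by move=> w H [l _ lw]; apply: H; exists l.
Qed.

Theorem theorem10 (R : realType) (lam mu : nat -> R)
  (lam_gt0 : forall i, 0 < lam i)
  (mu_gt0 : forall i, (1 <= i)%N -> 0 < mu i) (mu0 : mu 0%N = 0)
  (dO : measure_display) (Om : measurableType dO)
  (Pr : nat -> probability Om R) (Y : nat -> Om -> nat) (S : nat -> Om -> R)
  (process : birth_death_process lam mu Pr Y S)
  (nonexpl : non_explosive Pr S)
  (Q : nat -> {poly R}) (specQ : spectral_polynomials lam mu Q)
  (psi : probability R R) (specpsi : spectral_measure lam mu Pr Y S Q psi)
  (zeta : nat -> R) (discr : discrete_spectrum psi zeta)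
  (N : nat) (N_ge1 : (1 <= N)%N)
  (dT : measure_display) (T : measurableType dT) (P : probability T R)
  (Z : 'I_N -> {RV P >-> R}) (iidZ : iid_rvs Z psi)
  (x : nat -> nat) (sumx : \big[addn/0%N]_(j \in [set: nat]) x j = N) :
  let u := fun j l : nat => (Q j).[zeta l] in
  let n := fun w : T => occupation zeta (fun k => Z k w) in
  let NN := fun (j : nat) (w : T) => \sum_(k < N) (Q j).[Z k w] in
  let dual := fun w : T => dual_krawtchouk u (n w) x N in
  [/\ {ae P, forall w, forall j : nat, (1 <= j)%N ->
        NN j w = \sum_(l \in [set: nat]) (n w l)%:R * (Q j).[zeta l]},
      exists (M : nat) (F : mpoly.mpoly M R),
        [/\ forall j : nat, (M < j)%N -> x j = 0%N,
            leading_form (\big[addn/0%N]_(j \in [set j : nat | (1 <= j)%N]) x j)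
              F (mpoly.mpolyX R (mnm_shift M x)) &
            {ae P, forall w,
              dual w = mpoly.meval (fun i : 'I_M => NN i.+1 w) F}] &
      exists G : mpoly.mpoly N R,
        leading_form (\big[addn/0%N]_(j \in [set j : nat | (1 <= j)%N]) (j * x j)%N)
          G (monomial_sym N x) /\
        {ae P, forall w, dual w = mpoly.meval (fun k => Z k w) G}].
Proof.
move=> u n NN dual.
have sizeQ := size_spectral_polynomials lam_gt0 specQ.
have [zeta_inj _ _ psi0] := discr.
have Z_zeta := ae_range psi0 iidZ.
have [a xa] := exists_labelling N_ge1 sumx.
(* Because the atoms are distinct, occupation numbers are the fiber sizes of the labelling [b] of
   the sample by atoms. *)
have occupationE w (b : 'I_N -> nat) : (forall k, Z k w = zeta (b k)) ->
    forall l, #|[pred k | b k == l]| = n w l.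
  move=> Zb l; apply: eq_card => k; rewrite !inE Zb.
  by apply/eqP/eqP => [->|/zeta_inj].
(* [b] depends on [w], but the symmetrized product depends on it only through the points
   [zeta (b k) = Z k w]. *)
have dualE : {ae P, forall w,
    dual w = (N`!)%:R^-1 * sym_prod (Q \o a) (fun k => Z k w)}.
  apply: filterS Z_zeta => w /choice[b Zb].
  rewrite /dual (dual_krawtchoukE u xa (occupationE w b Zb)); congr (_ * _).
  by apply: eq_bigr => s _; apply: eq_bigr => k _; rewrite /u Zb.
split.
- apply: filterS Z_zeta => w /choice[b Zb] j _.
  rewrite /NN; under eq_bigr do rewrite Zb.
  rewrite -(fsbig_fiber _ b (fun l => (Q j).[zeta l])).
  by apply: eq_fsbigr => l _; rewrite iter_addr_0 (occupationE w) // mulr_natl.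
- have [F [F_lead FE]] := sym_prod_leading_power_sums xa sizeQ specQ.1.
  exists (\sum_(k < N) a k)%N, F; split.
  + move=> j aj; rewrite -xa card_fiber_gt //; apply: leq_ltn_trans aj.
    by apply/bigmax_leqP => k _; rewrite (bigD1 k) //= leq_addr.
  + rewrite -(fsum_pos_labels xa) in F_lead.
    rewrite (_ : \big[addn/0%N]_(j \in [set j : nat | (1 <= j)%N]) x j =
      \big[addn/0%N]_(j \in [set: nat]) ((j != 0) * x j)%N) //.
    rewrite fsbig_mkcond; apply: eq_fsbigr => j _.
    rewrite patchE; case: j => [|j]; rewrite ?mul1n.
      by rewrite memNset.
    by rewrite mem_set.
  + by apply: filterS dualE => w ->; rewrite FE.
have [G [G_lead GE]] := sym_prod_leading_form xa sizeQ.
exists G; split; last by apply: filterS dualE => w ->; rewrite GE.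
(* The added term [j = 0] is [0 * x 0], so the sum is unchanged. *)
rewrite (@fsbig_widen _ _ _ _ _ [set: nat]) ?(fsum_fiber_mul xa) //.
by move=> [|j] [_ /=] // /negP.
Qed.
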